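(* Fix a time $t\in\{0,\dots,T-1\}$. Let $\{\alpha_{t+1:T}^{n}\}_{n\in\mathbb N}$ be the sequence of risk allocations generated by Iterative Risk Allocation (IRA, defined in the context) from an initial allocation $\alpha_{t+1:T}^{0}$. Assume that there are $x_{t+1:T}^{0},u_{t:T-1}^{0}$ feasible for the lower-stage problem $\mathrm{(LS)}$ with risk allocation $\alpha_{t+1:T}^{0}$. If the sets $\mathcal X$ and $\mathcal U$ are bounded and the objective function $J(x_{t+1:T},u_{t:T-1})$ is continuous, then the sequence of optimal objective values $\{J^{*}(\alpha_{t+1:T}^{n})\}_{n\in\mathbb N}$ converges to a finite limit.
   Context: System: $x_{\tau+1}=f(x_\tau,u_\tau)$ with $f:\mathbb R^{n_x}\times\mathbb R^{n_u}\to\mathbb R^{n_x}$, state constraint set $\mathcal X\subseteq\mathbb R^{n_x}$, input constraint set $\mathcal U\subseteq\mathbb R^{n_u}$, mission time $T\ge 1$. Write $a_{s:r}=(a_s,\dots,a_r)$. The current state $x_t$ is given. Obstacles: $M$ obstacles with states in $\mathbb R^{n_p}$; $Y_\tau\in\mathbb R^{Mn_p}$ is the joint obstacle state at time $\tau$. At time $t$, $\hat Y_{\tau|t}$ is the given prediction of $Y_\tau$ ($\tau=t+1,\dots,T$). For each trajectory $Y^{(i)}$, $i=1,\dots,K$, of a calibration set $D_{cal}^1$, $\hat Y^{(i)}_{\tau|t}$ is the prediction of $Y^{(i)}_\tau$ obtained in the same way, and $R^{(i)}_{\tau|t}=\|Y^{(i)}_\tau-\hat Y^{(i)}_{\tau|t}\|$.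 Define $$C_{\tau|t}^{1-a}=\mathrm{Quantile}_{1-a}(R^{(1)}_{\tau|t},\dots,R^{(K)}_{\tau|t},\infty)=\inf\{z:\mathbb P\{Z\le z\}\ge 1-a\},$$ where $Z$ is distributed according to $\frac{1}{K+1}\big(\sum_{i=1}^K\delta_{R^{(i)}_{\tau|t}}+\delta_\infty\big)$. All this data is fixed at time $t$. The constraint function $c:\mathbb R^{n_x}\times\mathbb R^{Mn_p}\to\mathbb R$ is $L$-Lipschitz continuous. Objective: $J(x_{t+1:T},u_{t:T-1})=l_T(x_T)+\sum_{\tau=t}^{T-1}l_\tau(x_\tau,u_\tau)$. Lower-stage problem (LS) for an allocation $\alpha_{t+1:T}$: minimize $J(x_{t+1:T},u_{t:T-1})$ over $x_{t+1:T},u_{t:T-1}$ subject to $x_{\tau+1}=f(x_\tau,u_\tau)$ and $u_\tau\in\mathcal U$ for $\tau=t,\dots,T-1$, and $x_\tau\in\mathcal X$ and $c(x_\tau,\hat Y_{\tau|t})\ge L\,C_{\tau|t}^{1-\alpha_\tau}$ for $\tau=t+1,\dots,T$. Its feasible set is $\mathcal R_t(\alpha_{t+1:T})$ and its optimal value is $J^*(\alpha_{t+1:T})$. Feasible risk allocation: given a total risk tolerance $\alpha\in(0,1)$ and given numbers $\beta_1,\dots,\beta_t$ (posterior risks of past times), $\alpha_{t+1:T}$ is a feasible risk allocation if $\alpha_\tau\ge 0$ for all $\tau=t+1,\dots,T$, $\sum_{\tau=t+1}^T\alpha_\tau\le\alpha-\sum_{\tau=1}^t\beta_\tau$, and $\mathcal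 R_t(\alpha_{t+1:T})\neq\emptyset$. IRA: start from a feasible risk allocation $\alpha^0_{t+1:T}$ and fix a step size $\eta\in(0,1)$. Given the feasible risk allocation $\alpha^n_{t+1:T}$: 1. Solve (LS) with $\alpha^n_{t+1:T}$ to obtain an optimal solution $(x^n_{t+1:T},u^n_{t:T-1})$. 2. Put $\mathcal I_{act}=\{\tau\in\{t+1,\dots,T\}:c(x^n_\tau,\hat Y_{\tau|t})=L\,C_{\tau|t}^{1-\alpha^n_\tau}\}$, $\mathcal I_{ina}=\{t+1,\dots,T\}\setminus\mathcal I_{act}$, $N_{act}=|\mathcal I_{act}|$. 3. Set $\widetilde\alpha^n_\tau=\alpha^n_\tau$ for $\tau\in\mathcal I_{act}$ and $\widetilde\alpha^n_\tau=(1-\eta)\alpha^n_\tau+\eta\,\underline\alpha^n_\tau$ for $\tau\in\mathcal I_{ina}$, where $\underline\alpha^n_\tau=\frac{1}{1+K}\big(1+\sum_{i=1}^K\mathbb I(c(x^n_\tau,\hat Y_{\tau|t})<L R^{(i)}_{\tau|t})\big)$ and $\mathbb I$ is the indicator function. 4. Set $\alpha^{n+1}_\tau=\widetilde\alpha^n_\tau+\frac{1}{N_{act}}\big(\alpha-\sum_{s=1}^t\beta_s-\sum_{s=t+1}^T\widetilde\alpha^n_s\big)$ for $\tau\in\mathcal I_{act}$, and $\alpha^{n+1}_\tau=\widetilde\alpha^n_\tau$ for $\tau\in\mathcal I_{ina}$. *)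

(* Defs.v *)
From mathcomp Require Import all_boot all_order all_algebra.
From mathcomp Require Import all_classical all_reals all_analysis.
From mathcomp Require Import measurable_realfun.

Set Implicit Arguments.
Unset Strict Implicit.
Unset Printing Implicit Defensive.

Import Order.TTheory GRing.Theory Num.Theory numFieldNormedType.Exports.

Local Open Scope classical_set_scope.
Local Open Scope ring_scope.

(* The library norm on matrices is the sup norm. *)
Definition enorm (R : realType) (n : nat) (v : 'rV[R]_n) : R :=
  Num.sqrt (\sum_(j < n) v ord0 j ^+ 2).

Definition jointly_lipschitz (R : realType) (m n : nat) (L : R)
    (c : 'rV[R]_m -> 'rV[R]_n -> R) : Prop :=
  forall (x x' : 'rV[R]_m) (y y' : 'rV[R]_n),
    `|c x y - c x' y'| <= L * enorm (row_mx (x - x') (y - y')).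

Section Quantile.
Context (R : realType).
Local Open Scope ereal_scope.

Definition calibration_law (K : nat) (s : 'I_K -> R) (A : set (\bar R)) : \bar R :=
  (K.+1%:R^-1)%:E * (\sum_(i < K) dirac (s i)%:E A + dirac +oo A).

Definition quantile (mu : set (\bar R) -> \bar R) (p : R) : \bar R :=
  ereal_inf [set z | p%:E <= mu [set w | w <= z]].

End Quantile.

(* [x_cur] is x_t; [Yhat tau] is the prediction made at time t of the obstacle
   state at time tau, and [Yhat_cal k tau] that of [Ycal k tau]. Times are
   absolute. *)
Record problem (R : realType) (nx nu M np K : nat) := Problem {
  dyn : 'rV[R]_nx -> 'rV[R]_nu -> 'rV[R]_nx;
  state_set : set 'rV[R]_nx;
  input_set : set 'rV[R]_nu;
  x_cur : 'rV[R]_nx;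
  Yhat : nat -> 'rV[R]_(M * np);
  Ycal : 'I_K -> nat -> 'rV[R]_(M * np);
  Yhat_cal : 'I_K -> nat -> 'rV[R]_(M * np);
  constr : 'rV[R]_nx -> 'rV[R]_(M * np) -> R;
  Lip : R;
  stage_cost : nat -> 'rV[R]_nx -> 'rV[R]_nu -> R;
  final_cost : 'rV[R]_nx -> R
}.

Section RiskAllocation.
Context (R : realType) (nx nu M np K T t : nat).
Variable P : problem R nx nu M np K.

(* Index i is the time t + 1 + i. *)
Definition allocation := 'I_(T - t) -> R.

(* Row i of the first component is x_(t+1+i), row i of the second is u_(t+i). *)
Definition plan := ('M[R]_(T - t, nx) * 'M[R]_(T - t, nu))%type.

Definition future (i : 'I_(T - t)) : nat := (t + 1 + i)%N.

(* Rows 0, ..., T - t are x_t, x_(t+1), ..., x_T. *)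
Definition full_path (z : plan) : 'M[R]_((T - t).+1, nx) :=
  col_mx (x_cur P) z.1.

Definition state_before (z : plan) (i : 'I_(T - t)) : 'rV[R]_nx :=
  row (widen_ord (leqnSn (T - t)) i) (full_path z).

Definition state_after (z : plan) (i : 'I_(T - t)) : 'rV[R]_nx := row i z.1.

Definition input (z : plan) (i : 'I_(T - t)) : 'rV[R]_nu := row i z.2.

Definition cost (z : plan) : R :=
  final_cost P (row ord_max (full_path z)) +
  \sum_(i < T - t) stage_cost P (t + i) (state_before z i) (input z i).

Definition score (i : 'I_K) (tau : nat) : R :=
  enorm (Ycal P i tau - Yhat_cal P i tau).

(* [conformal_radius tau a] is C_(tau|t)^(1-a). *)
Definition conformal_radius (tau : nat) (a : R) : \bar R :=
  quantile (calibration_law (fun i => score i tau)) (1 - a).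

Definition margin (z : plan) (i : 'I_(T - t)) : R :=
  constr P (state_after z i) (Yhat P (future i)).

(* In [\bar R], 0 * +oo = 0 * -oo = 0; this only matters when Lip P = 0. *)
Definition required_margin (a : allocation) (i : 'I_(T - t)) : \bar R :=
  ((Lip P)%:E * conformal_radius (future i) (a i))%E.

Definition LS_feasible (a : allocation) : set plan :=
  [set z : plan |
    (forall i, state_after z i = dyn P (state_before z i) (input z i)) /\
    (forall i, input_set P (input z i)) /\
    (forall i, state_set P (state_after z i)) /\
    (forall i, (required_margin a i <= (margin z i)%:E)%E)].

Definition LS_value (a : allocation) : \bar R :=
  ereal_inf [set (cost z)%:E | z in LS_feasible a].

Definition LS_optimal (a : allocation) (z : plan) : Prop :=
  LS_feasible a z /\ forall z', LS_feasible a z' -> cost z <= cost z'.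

Definition remaining_risk (alpha : R) (beta : nat -> R) : R :=
  alpha - \sum_(1 <= s < t.+1) beta s.

Definition feasible_allocation (alpha : R) (beta : nat -> R)
    (a : allocation) : Prop :=
  (forall i, 0 <= a i) /\
  \sum_(i < T - t) a i <= remaining_risk alpha beta /\
  LS_feasible a !=set0.

Definition active (a : allocation) (z : plan) (i : 'I_(T - t)) : bool :=
  (margin z i)%:E == required_margin a i.

Definition num_active (a : allocation) (z : plan) : nat :=
  #|[pred i | active a z i]|.

Definition used_risk (z : plan) (i : 'I_(T - t)) : R :=
  (1 + K%:R)^-1 *
  (1 + \sum_(k < K) (margin z i < Lip P * score k (future i))%R%:R).

Definition tightened (eta : R) (a : allocation) (z : plan) : allocation :=
  fun i => if active a z i then a i
           else (1 - eta) * a i + eta * used_risk z i.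

Definition IRA_update (alpha : R) (beta : nat -> R) (eta : R)
    (a : allocation) (z : plan) : allocation :=
  fun i =>
    if active a z i then
      tightened eta a z i +
      (num_active a z)%:R^-1 *
      (remaining_risk alpha beta - \sum_(j < T - t) tightened eta a z j)
    else tightened eta a z i.

(* (LS) may have several optimal solutions: [z n] is whichever one the run
   computes at iteration n. *)
Definition IRA_run (alpha : R) (beta : nat -> R) (eta : R)
    (a : nat -> allocation) (z : nat -> plan) : Prop :=
  feasible_allocation alpha beta (a 0%N) /\
  forall n, LS_optimal (a n) (z n) /\
            forall i, a n.+1 i = IRA_update alpha beta eta (a n) (z n) i.

End RiskAllocation.

(* Main.v *)
Require Import Defs.
From mathcomp Require Import all_boot all_order all_algebra.
From mathcomp Require Import all_classical all_reals all_analysis.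
From mathcomp Require Import measurable_realfun.
Import Order.TTheory GRing.Theory Num.Theory numFieldNormedType.Exports.
Local Open Scope classical_set_scope.
Local Open Scope ring_scope.

(** The optimal values form a nonincreasing sequence that is bounded below.

    Monotonicity: the optimal plan computed for one allocation is still feasible
    for the next one ([LS_feasible_IRA_update]), so the next optimal cost cannot
    be larger. Let [L] be the Lipschitz constant. If [L > 0], the constraint at a
    given time asks that [margin / L] be at least the conformal radius, the
    quantile of order [1 - a] of the calibration law. The risk level
    [used_risk] of IRA is exactly one minus the mass of that law on scores at
    most [margin / L] ([calibration_law_used_risk]). Therefore an inactive
    constraint has been allocated at least [used_risk] ([used_risk_le]), and any
    risk at least [used_risk] would let the same margin through
    ([required_margin_le]). Moving an inactive allocation towards [used_risk]
    thus keeps the plan feasible and never consumes budget; as the total stays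
    within the remaining risk ([sum_IRA_update_le]), the surplus is nonnegative,
    and giving it to the active times only shrinks their conformal radius. If
    [L = 0], the required margin is [0] for all allocations and all the
    lower-stage problems coincide.

    Lower bound: every feasible plan has its states and inputs in bounded sets,
    so it lies in a fixed compact box of pairs of matrices, on which the
    continuous cost has a minimum ([cost_bounded_below]). *)

Lemma le_calibration_law {R : realType} {K : nat} (s : 'I_K -> R)
    (A B : set (\bar R)) :
  A `<=` B -> (calibration_law s A <= calibration_law s B)%E.
Proof.
move=> AB; have dirac_le (x : \bar R) : (dirac x A <= dirac x B :> \bar R)%E.
  rewrite !diracE lee_fin ler_nat; have [xA|//] := boolP (x \in A).
  by rewrite (mem_set (AB _ (set_mem xA))).
apply: lee_wpmul2l; first by rewrite lee_fin invr_ge0 ler0n.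
by apply: leeD => //; apply: lee_sum.
Qed.

(** The atom at infinity never counts below a finite level, hence the sum over
    the [K] scores alone, still divided by [K + 1]. *)
Lemma calibration_law_le {R : realType} {K : nat} (s : 'I_K -> R) (r : R) :
  calibration_law s [set w | (w <= r%:E)%E] =
  (K.+1%:R^-1 * \sum_(k < K) (s k <= r)%R%:R)%:E.
Proof.
rewrite /calibration_law diracE memNset ?adde0; last by rewrite /= leye_eq.
rewrite EFinM -sumEFin; congr (_ * _)%E; apply: eq_bigr => k _.
by rewrite diracE; congr (_%:R%:E); congr nat_of_bool; apply/idP/idP;
  rewrite ?inE /= lee_fin.
Qed.

Lemma le_quantile {R : realType} (mu : set (\bar R) -> \bar R) (p q : R) :
  p <= q -> (quantile mu p <= quantile mu q)%E.
Proof.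
move=> pq; apply: ereal_inf_le_tmp => w /=; apply: le_trans.
by rewrite lee_fin.
Qed.

Section Certificates.
Context {R : realType} {nx nu M np K T t : nat}.
Variable P : problem R nx nu M np K.
Implicit Types (a b : allocation R T t) (z : plan R nx nu T t).

Lemma required_margin_antitone a b i : 0 <= Lip P -> a i <= b i ->
  (required_margin P b i <= required_margin P a i)%E.
Proof.
move=> L0 ab; apply: lee_wpmul2l; first by rewrite lee_fin.
by apply: le_quantile; rewrite lerB.
Qed.

(** The meaning of the IRA quantity [used_risk]: it is the miscoverage
    probability, under the calibration law, of the radius [margin / L], which is
    the largest prediction error that the Lipschitz bound lets the plan absorb
    at that time. *)
Lemma calibration_law_used_risk z i : 0 < Lip P ->
  calibration_law (fun k => score P k (future i))
    [set w | (w <= (margin P z i / Lip P)%:E)%E] =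
  (1 - used_risk P z i)%:E.
Proof.
move=> L0; rewrite calibration_law_le; congr (_%:E).
have compl : \sum_(k < K) (margin P z i < Lip P * score P k (future i))%R%:R =
    K%:R - \sum_(k < K) (score P k (future i) <= margin P z i / Lip P)%R%:R :> R.
  rewrite -[X in X%:R - _](card_ord K) -sum1_card natr_sum -sumrB.
  apply: eq_bigr => k _; rewrite ler_pdivlMr// [score _ _ _ * _]mulrC leNgt.
  by case: (_ < _); rewrite /= ?subr0 ?subrr.
rewrite /used_risk compl addrA nat1r mulrBr mulVf ?pnatr_eq0//.
by rewrite opprB addrCA subrr addr0.
Qed.

(** A quantile strictly below [margin / L] has some level below [margin / L]
    carrying mass at least [1 - a i], so [margin / L] carries that mass too.
    Strictness avoids having to know that the infimum in the quantile is
    attained. *)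
Lemma used_risk_le {z a i} : 0 < Lip P ->
  (required_margin P a i < (margin P z i)%:E)%E -> used_risk P z i <= a i.
Proof.
move=> L0; rewrite /required_margin -lte_pdivlMl// => /ereal_inf_lt[w /= aw wm].
suff : 1 - a i <= 1 - used_risk P z i by rewrite lerD2l lerN2.
rewrite -lee_fin -calibration_law_used_risk//; apply: (le_trans aw).
apply: le_calibration_law => v /= vw; apply: (le_trans vw).
by apply: (le_trans (ltW wm)); rewrite -EFinM mulrC.
Qed.

(** The level [margin / L] itself competes in the infimum defining the
    quantile at any risk at least [used_risk]. Together with [used_risk_le],
    this makes [used_risk] the exact price of the current margin: an inactive
    constraint pays at least that much, and paying that much suffices. *)
Lemma required_margin_le z a i : 0 < Lip P -> used_risk P z i <= a i ->
  (required_margin P a i <= (margin P z i)%:E)%E.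
Proof.
move=> L0 ua; rewrite /required_margin -lee_pdivlMl//.
apply: ereal_inf_lbound => /=; rewrite -EFinM [_^-1 * _]mulrC.
by rewrite calibration_law_used_risk// lee_fin lerB.
Qed.

Lemma inactive_slack {a z i} : LS_feasible P a z -> ~~ active P a z i ->
  (required_margin P a i < (margin P z i)%:E)%E.
Proof. by move=> [_ [_ [_ fz]]] ina; rewrite lt_neqAle eq_sym ina fz. Qed.

(** A convex combination of [a i] and [used_risk] stays between the two, because
    slack in the constraint means that [used_risk <= a i]. *)
Lemma tightened_ge_used_risk eta a z i : 0 < Lip P -> eta <= 1 ->
  LS_feasible P a z -> ~~ active P a z i ->
  used_risk P z i <= tightened P eta a z i.
Proof.
move=> L0 eta1 fz ina; rewrite /tightened (negbTE ina).
have ua := used_risk_le L0 (inactive_slack fz ina).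
rewrite -[leLHS]mul1r -{1}(subrK eta 1) mulrDl lerD2r.
by rewrite ler_wpM2l// subr_ge0.
Qed.

Lemma tightened_le eta a z i : 0 < Lip P -> 0 <= eta -> LS_feasible P a z ->
  tightened P eta a z i <= a i.
Proof.
move=> L0 eta0 fz; rewrite /tightened; case: ifPn => // ina.
have ua := used_risk_le L0 (inactive_slack fz ina).
rewrite -[leRHS]mul1r -{2}(subrK eta 1) [leRHS]mulrDl lerD2l.
by rewrite ler_wpM2l.
Qed.

(** Tightening frees risk and the active times receive exactly the surplus, so
    the total becomes the whole budget, or stays the tightened total when there
    is no active time. *)
Lemma sum_IRA_update_le alpha beta eta a z : 0 < Lip P -> 0 <= eta ->
  LS_feasible P a z -> \sum_i a i <= remaining_risk t alpha beta ->
  \sum_i IRA_update P alpha beta eta a z i <= remaining_risk t alpha beta.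
Proof.
move=> L0 eta0 fz ar; set r := remaining_risk t alpha beta.
set b := tightened P eta a z.
have br : \sum_i b i <= r.
  by apply: le_trans ar; apply: ler_sum => i _; exact: tightened_le.
pose N := num_active P a z.
have -> : \sum_i IRA_update P alpha beta eta a z i =
    \sum_i b i + N%:R * (N%:R^-1 * (r - \sum_j b j)).
  rewrite mulr_natl -sumr_const [X in _ + X]big_mkcond -big_split /=.
  apply: eq_bigr => i _; rewrite /IRA_update inE.
  by case: ifP => _; rewrite ?addr0.
(* With no active time the surplus is not distributed, and [0^-1 = 0]. *)
have [->|N0] := eqVneq N 0; first by rewrite mul0r addr0.
by rewrite mulVKf ?pnatr_eq0// addrC subrK.
Qed.

(** The step behind monotonicity: the old plan survives the reallocation. Active
    times get more risk, hence a weaker requirement; inactive times keep at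
    least [used_risk], which is enough for the margin they have. The budget is
    only assumed for a positive Lipschitz constant, as [IRA_update] need not
    preserve it when the constant is zero: then [0 * +oo = 0] admits allocations
    below [1 / (K + 1)], which tightening increases. *)
Lemma LS_feasible_IRA_update alpha beta eta a z : 0 <= Lip P -> 0 <= eta <= 1 ->
  LS_feasible P a z ->
  (0 < Lip P -> \sum_i a i <= remaining_risk t alpha beta) ->
  LS_feasible P (IRA_update P alpha beta eta a z) z.
Proof.
move=> L0 /andP[eta0 eta1] fz ar; have [fdyn [fin [fst fmargin]]] := fz.
do 3!split=> //; move=> i; move: L0; rewrite le_eqVlt => /predU1P[L0|L0].
  (* The required margin is [0] for every allocation. *)
  by move: (fmargin i); rewrite /required_margin -L0 !mul0e.
have [act|ina] := boolP (active P a z i); last first.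
  apply: required_margin_le => //; rewrite /IRA_update (negbTE ina).
  exact: tightened_ge_used_risk.
apply: le_trans (fmargin i); apply: required_margin_antitone; first exact: ltW.
rewrite /IRA_update act {1}/tightened act lerDl mulr_ge0 ?invr_ge0 ?ler0n//.
rewrite subr_ge0; apply: le_trans (ar L0).
by apply: ler_sum => j _; exact: tightened_le.
Qed.

Lemma LS_value_optimal {a z} : LS_optimal P a z -> LS_value P a = (cost P z)%:E.
Proof.
move=> [fz optz]; apply/eqP; rewrite eq_le; apply/andP; split.
  by apply: ereal_inf_lbound; exists z.
by apply: le_ereal_inf_tmp => _ [z' fz' <-]; rewrite lee_fin; exact: optz.
Qed.

End Certificates.

Lemma vec_mx_continuous {R : realType} (m n : nat) :
  continuous (vec_mx : 'rV[R]_(m * n) -> 'M[R]_(m, n)).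
Proof.
move=> v A /nbhs_ballP[e e0 eA]; apply/nbhs_ballP; exists e => // w [_ vw].
by apply: eA; split=> // i j; rewrite !mxE.
Qed.

(** The compactness of boxes of row vectors transfers along the flattening of
    matrices. *)
Lemma compact_box_mx {R : realType} (m n : nat) (B : R) :
  compact [set A : 'M[R]_(m, n) | forall i j, A i j \in `[- B, B]].
Proof.
set C := (X in compact X).
have -> : C = vec_mx @` [set v : 'rV_(m * n) | forall k, v 0 k \in `[- B, B]].
  apply/seteqP; split=> [A CA|_ [v Bv <-] i j]; last by rewrite mxE.
  exists (mxvec A); last exact: mxvecK.
  by move=> k; case/mxvec_indexP: k => i j; rewrite mxvecE.
apply: continuous_compact; first exact/continuous_subspaceT/vec_mx_continuous.
apply: (@rV_compact _ _ (fun=> `[- B, B]%classic)) => _.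
exact: segment_compact.
Qed.

(** The norm of vectors being the sup norm, a bound on the rows is a bound on the
    entries. *)
Lemma rows_bounded {R : realType} {n : nat} (S : set 'rV[R]_n) : bounded_set S ->
  exists B : R, forall m (A : 'M[R]_(m, n)), (forall i, S (row i A)) ->
    forall i j, A i j \in `[- B, B].
Proof.
move=> [B0 [_ SB]]; exists (B0 + 1) => m A SA i j.
have B1 : B0 < B0 + 1 by rewrite ltrDl.
move: (SB _ B1 _ (SA i)) => /=.
rewrite in_itv /= -ler_norml [X in X <= _ -> _]/Num.norm /= mx_normrE; apply: le_trans.
by apply/bigmax_geP; right; exists (ord0, j) => //=; rewrite mxE.
Qed.

(** One lower bound serves all allocations: whatever the risk, feasible plans have
    their states and inputs in the bounded constraint sets, so they lie in one
    compact box. The state and input sets need not be closed, hence the minimum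
    is taken over the box and not over a feasible set. *)
Lemma cost_bounded_below {R : realType} {nx nu M np K T t : nat}
    (P : problem R nx nu M np K) :
  bounded_set (state_set P) -> bounded_set (input_set P) ->
  continuous (fun y : plan R nx nu T t => cost P y) ->
  exists l : R, forall (a : allocation R T t) z, LS_feasible P a z ->
    l <= cost P z.
Proof.
move=> /rows_bounded[BX hX] /rows_bounded[BU hU] costC.
pose box (m n : nat) B := [set A : 'M[R]_(m, n) | forall i j, A i j \in `[- B, B]].
pose D : set (plan R nx nu T t) := box _ _ BX `*` box _ _ BU.
have feasD a z : LS_feasible P a z -> D z.
  by move=> [_ [zU [zX _]]]; split; [exact: hX zX | exact: hU zU].
have [D0|/set0P D0] := eqVneq D set0.
  by exists 0 => a z /feasD; rewrite D0.
have Dco : compact D by apply: compact_setX; exact: compact_box_mx.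
have [c _ cmin] := compact_EVT_min D0 Dco (continuous_subspaceT costC).
by exists (cost P c) => a z /feasD Dz; apply: cmin; rewrite inE.
Qed.

Theorem theorem5p3 (R : realType) (nx nu M np K T t : nat)
    (hT : (1 <= T)%N) (htT : (t < T)%N)
    (P : problem R nx nu M np K)
    (hL : 0 <= Lip P) (hc : jointly_lipschitz (Lip P) (constr P))
    (alpha : R) (halpha : 0 < alpha < 1) (beta : nat -> R)
    (eta : R) (heta : 0 < eta < 1)
    (a : nat -> allocation R T t) (z : nat -> plan R nx nu T t)
    (hIRA : IRA_run P alpha beta eta a z)
    (hfeas : exists z0 : plan R nx nu T t, LS_feasible P (a 0%N) z0)
    (hX : bounded_set (state_set P)) (hU : bounded_set (input_set P))
    (hJ : continuous (fun y : plan R nx nu T t => cost P y)) :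
  exists l : R, (fun n => LS_value P (a n)) @ \oo --> l%:E.
Proof.
have [[_ [a0r _]] step] := hIRA; have /andP[eta0 eta1] := heta.
have fz n : LS_feasible P (a n) (z n) by have [[]] := step n.
have aS n : a n.+1 = IRA_update P alpha beta eta (a n) (z n).
  by apply/funext => i; have [_ ->] := step n.
have budget n : 0 < Lip P -> \sum_i a n i <= remaining_risk t alpha beta.
  move=> L0; elim: n => // n IHn; rewrite aS.
  by apply: sum_IRA_update_le => //; exact: ltW.
have cost_noninc : nonincreasing_seq (fun n => cost P (z n)).
  apply/nonincreasing_seqP => n; have [[_ opt] _] := step n.+1; apply: opt.
  by rewrite aS; apply: LS_feasible_IRA_update => //; [rewrite !ltW|exact: budget].
have [l lb] := cost_bounded_below (T := T) (t := t) P hX hU hJ.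
have /cvg_ex[J cvgJ] : cvgn (fun n => cost P (z n)).
  apply: nonincreasing_is_cvgn => //; exists l => _ [n _ <-].
  exact: lb (fz n).
exists J; have -> : (fun n => LS_value P (a n)) = EFin \o (fun n => cost P (z n)).
  by apply/funext => n; apply: LS_value_optimal; have [] := step n.
by apply: cvg_EFin => //; exact: nearW.
Qed.
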